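(* Let $(X,\tau,\mathcal{I},\mathfrak{a})$ be an ideal-aura topological space. If the scope function $\mathfrak{a}$ is transitive, then $\operatorname{cl}^{*}_{\mathfrak{a}}$ is idempotent (hence a Kuratowski closure operator), and $\tau^{*}_{\mathfrak{a}}=\tau^{*c}_{\mathfrak{a}}$.
   Context: An ideal on a set $X$ is a non-empty collection $\mathcal{I}\subseteq\mathcal{P}(X)$ closed under taking subsets and finite unions. A scope function on a topological space $(X,\tau)$ is a function $\mathfrak{a}:X\to\tau$ with $x\in\mathfrak{a}(x)$ for every $x\in X$; it is transitive if $y\in\mathfrak{a}(x)$ implies $\mathfrak{a}(y)\subseteq\mathfrak{a}(x)$ for all $x,y\in X$. An ideal-aura topological space $(X,\tau,\mathcal{I},\mathfrak{a})$ is a topological space $(X,\tau)$ with an ideal $\mathcal{I}$ on $X$ and a scope function $\mathfrak{a}:X\to\tau$. For $A\subseteq X$: $A^{\mathfrak{a}}(\mathcal{I})=\{x\in X:\mathfrak{a}(x)\cap A\notin\mathcal{I}\}$; $\operatorname{cl}^{*}_{\mathfrak{a}}(A)=A\cup A^{\mathfrak{a}}(\mathcal{I})$; $\operatorname{cl}^{*0}_{\mathfrak{a}}(A)=A$, $\operatorname{cl}^{*(n+1)}_{\mathfrak{a}}(A)=\operatorname{cl}^{*}_{\mathfrak{a}}(\operatorname{cl}^{*n}_{\mathfrak{a}}(A))$, and $\operatorname{cl}^{*\infty}_{\mathfrak{a}}(A)=\bigcup_{n=0}^{\infty}\operatorname{cl}^{*n}_{\mathfrak{a}}(A)$. Idempotent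 means $\operatorname{cl}^{*}_{\mathfrak{a}}(\operatorname{cl}^{*}_{\mathfrak{a}}(A))=\operatorname{cl}^{*}_{\mathfrak{a}}(A)$ for all $A\subseteq X$. A Kuratowski closure operator is an operator $c$ on $\mathcal{P}(X)$ with $c(\emptyset)=\emptyset$, $A\subseteq c(A)$, $c(A\cup B)=c(A)\cup c(B)$ and $c(c(A))=c(A)$. $\tau^{*}_{\mathfrak{a}}=\{A\subseteq X:\operatorname{cl}^{*\infty}_{\mathfrak{a}}(X\setminus A)=X\setminus A\}$ and $\tau^{*c}_{\mathfrak{a}}=\{A\subseteq X:\operatorname{cl}^{*}_{\mathfrak{a}}(X\setminus A)=X\setminus A\}$. *)

(* Defs.v *)
From mathcomp Require Import all_boot.
From mathcomp Require Import boolp classical_sets functions topology.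

Set Implicit Arguments.
Unset Strict Implicit.
Unset Printing Implicit Defensive.

Local Open Scope classical_set_scope.

(* An ideal need not be proper: [set: set X] is allowed. *)
Record is_ideal (X : Type) (I : set (set X)) : Prop := IsIdeal {
  ideal_nonempty : I !=set0 ;
  ideal_subset : forall A B : set X, B `<=` A -> I A -> I B ;
  ideal_setU : forall A B : set X, I A -> I B -> I (A `|` B) }.

Record is_scope (X : topologicalType) (a : X -> set X) : Prop := IsScope {
  scope_open : forall x : X, open (a x) ;
  scope_mem : forall x : X, a x x }.

Definition transitive_scope (X : Type) (a : X -> set X) : Prop :=
  forall x y : X, a x y -> a y `<=` a x.

Record is_ideal_aura (X : topologicalType) (I : set (set X))
    (a : X -> set X) : Prop := IsIdealAura {
  ideal_aura_ideal : is_ideal I ;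
  ideal_aura_scope : is_scope a }.

Section AuraOperators.
Variables (X : Type) (I : set (set X)) (a : X -> set X).

Definition aura_local (A : set X) : set X := [set x | ~ I (a x `&` A)].

Definition aura_cl (A : set X) : set X := A `|` aura_local A.

Definition aura_cl_iter (n : nat) (A : set X) : set X := iter n aura_cl A.

Definition aura_cl_infty (A : set X) : set X :=
  \bigcup_n aura_cl_iter n A.

Definition aura_tau : set (set X) :=
  [set A | aura_cl_infty (~` A) = ~` A].

Definition aura_tau_c : set (set X) :=
  [set A | aura_cl (~` A) = ~` A].

End AuraOperators.

Record is_kuratowski_closure (X : Type) (c : set X -> set X) : Prop :=
  IsKuratowskiClosure {
    kuratowski0 : c set0 = set0 ;
    kuratowski_subset : forall A : set X, A `<=` c A ;
    kuratowskiU : forall A B : set X, c (A `|` B) = c A `|` c B ;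
    kuratowski_idem : idempotent_fun c }.

(* Main.v *)
(* If x lies outside the local function of A, that is, a(x) `&` A belongs to the
   ideal, then transitivity makes every y in a(x) lie outside it too. Hence a(x)
   meets the closure of A exactly in a(x) `&` A, and closing twice adds no new
   point. *)
Require Import Defs.
From mathcomp Require Import all_boot.
From mathcomp Require Import boolp classical_sets functions topology.

Local Open Scope classical_set_scope.

Lemma ideal_set0 (X : Type) (I : set (set X)) : is_ideal I -> I set0.
Proof. by move=> hI; have [A IA] := ideal_nonempty hI; apply: ideal_subset IA. Qed.

Lemma aura_cl0 (X : Type) (I : set (set X)) (a : X -> set X) :
  is_ideal I -> aura_cl I a set0 = set0.
Proof.
move=> hI; rewrite /aura_cl set0U -subset0 => x; apply.
by rewrite setI0; exact: ideal_set0.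
Qed.

(** The trace of a union on [a x] is the union of the two traces, and an ideal contains a union
    exactly when it contains both parts. *)
Lemma aura_localU (X : Type) (I : set (set X)) (a : X -> set X) (A B : set X) :
  is_ideal I -> aura_local I a (A `|` B) = aura_local I a A `|` aura_local I a B.
Proof.
move=> hI; apply/seteqP; split=> x /=; rewrite /aura_local /= setIUr.
  move=> nIAB; have [IA|] := pselect (I (a x `&` A)); last by left.
  by right=> IB; apply: nIAB; exact: ideal_setU.
by case=> nI IAB; apply: nI; apply: (ideal_subset hI) IAB;
  [exact: subsetUl | exact: subsetUr].
Qed.

Lemma aura_clU (X : Type) (I : set (set X)) (a : X -> set X) (A B : set X) :
  is_ideal I -> aura_cl I a (A `|` B) = aura_cl I a A `|` aura_cl I a B.
Proof. by move=> hI; rewrite /aura_cl aura_localU// setUACA. Qed.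

Lemma aura_cl_idempotent (X : Type) (I : set (set X)) (a : X -> set X) :
  is_ideal I -> transitive_scope a -> idempotent_fun (aura_cl I a).
Proof.
move=> hI ha A; apply/seteqP; split; last exact: subsetUl.
(* By [IA], it suffices that [a x] meets the closure of [A] only in points of [A]. *)
move=> x [//|nIcl]; right=> IA; apply: nIcl; apply: (ideal_subset hI) (IA).
move=> y [axy [Ay|nIy]]; first by split.
exfalso; apply: nIy; apply: (ideal_subset hI) IA.
by apply: setSI; exact: ha.
Qed.

(** The union of the iterates contains the first one, [aura_cl I a A]; conversely, a fixed point of
    [aura_cl] is fixed by every iterate. *)
Lemma aura_cl_infty_fixed (X : Type) (I : set (set X)) (a : X -> set X)
    (A : set X) :
  aura_cl_infty I a A = A <-> aura_cl I a A = A.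
Proof.
split=> [AE|AE].
  apply/seteqP; split; last exact: subsetUl.
  by move=> x clx; rewrite -AE; exists 1%N.
apply/seteqP; split=> [x [n _]|x Ax]; last by exists 0%N.
by rewrite /aura_cl_iter iter_fix.
Qed.

Theorem theorem4p11 (X : topologicalType) (I : set (set X)) (a : X -> set X)
    (hIa : is_ideal_aura I a) (ha : transitive_scope a) :
  [/\ idempotent_fun (aura_cl I a),
      is_kuratowski_closure (aura_cl I a)
    & aura_tau I a = aura_tau_c I a].
Proof.
have hI := ideal_aura_ideal hIa.
have idem := aura_cl_idempotent _ _ _ hI ha.
split=> //.
  split=> // [|A|A B]; [exact: aura_cl0 | exact: subsetUl | exact: aura_clU].
(* Both families are given by a fixed-point condition on the complement of [A]. *)
by apply/seteqP; split=> A /aura_cl_infty_fixed.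
Qed.
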